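(* Let $\varphi=f+g$, where $f\in\mathcal{F}^{1,1}_L(\mathbb{R}^n)$ and $g\in\Gamma_0(\mathbb{R}^n)$, achieve its minimum $\min\varphi$. Let $\epsilon>0$ be a fixed constant and set $\Omega=\{x:\varphi(x)\le\min\varphi+\epsilon\}$. Starting from $x_0\in\Omega$, the forward-backward splitting (FBS) algorithm is defined by $$x_{k+1}=\mathbf{prox}_{\frac1Lg}\left(x_k-\tfrac1L\nabla f(x_k)\right)=x_k-\tfrac1L\mathcal{R}_{1/L}(x_k),\quad k\ge0.$$ Denote $S_k:=\sum_{i=0}^\infty\|\mathcal{R}_{1/L}(x_{k+i})\|^2$, $k\ge0$. (i) If $\varphi$ satisfies the $(\mathcal{R}_{1/L},\nu,\Omega)$-(cor-EB) condition with $\nu<2L$, then FBS converges linearly in the sense that, for all $k\ge0$, $$\varphi(x_{k+1})-\min\varphi\le\left(1-\frac{\nu}{2L}\right)(\varphi(x_k)-\min\varphi),$$ $$d^2(x_{k+1},\mathrm{Arg}\min\varphi)\le\left(1-\frac{\nu}{2L}\right)d^2(x_k,\mathrm{Arg}\min\varphi),$$ $$S_{k+1}\le\left(1-\frac{\nu}{2L}\right)S_k.$$ (ii) Conversely, if, starting from an arbitrary initial point $x_0\in\Omega$, FBS converges linearly in the sense that $d^2(x_{k+1},\mathrm{Arg}\min\varphi)\le\tau\,d^2(x_k,\mathrm{Arg}\min\varphi)$ for all $k\ge0$ with a constant $\tau\in(0,1)$, then $\varphi$ satisfies the $(\mathcal{R}_{1/L},\nu,\Omega)$-(cor-EB) condition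 with $\nu=\frac L2(1-\sqrt\tau)^2$.
   Context: $\mathcal{F}^{1,1}_L(\mathbb{R}^n)$ ($L>0$) is the class of differentiable convex functions $f:\mathbb{R}^n\to\mathbb{R}$ with $\|\nabla f(x)-\nabla f(y)\|\le L\|x-y\|$ for all $x,y$; $\Gamma_0(\mathbb{R}^n)$ is the class of proper lower semicontinuous convex functions $\mathbb{R}^n\to(-\infty,+\infty]$. $\mathbf{prox}_{\lambda g}(x)=\arg\min_y\{g(y)+\frac1{2\lambda}\|y-x\|^2\}$, and $\mathcal{R}_{1/L}(x)=L\left(x-\mathbf{prox}_{\frac1Lg}(x-\frac1L\nabla f(x))\right)$. $\mathrm{Arg}\min\varphi$ is the set of minimizers of $\varphi$, which equals $\mathrm{crit}\,\varphi=\{x:0\in\partial\varphi(x)\}$ by convexity; $d(x,Q)=\inf_{y\in Q}\|x-y\|$; $\mathrm{dom}\,\varphi=\{x:\varphi(x)<+\infty\}$; $\mathcal{P}_\varphi(x)$ is the set of points of $\mathrm{crit}\,\varphi$ nearest to $x$. The $(\mathcal{R}_{1/L},\nu,\Omega)$-(cor-EB) condition (with $\nu>0$) means: for all $x\in\Omega\cap\mathrm{dom}\,\varphi$, $\inf_{x_p\in\mathcal{P}_\varphi(x)}\langle\mathcal{R}_{1/L}(x),x-x_p\rangle\ge\nu\,d^2(x,\mathrm{crit}\,\varphi)$. *)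

(* Defs.v *)
(* R^n is 'rV[R]_n.  The library's norm on 'rV[R]_n is the
   sup norm; it induces the usual topology (so [differentiable] and
   [lower_semicontinuous] have their usual meaning), but all metric notions
   below use the Euclidean norm [enorm]. *)
From HB Require Import structures.
From mathcomp Require Import all_boot all_order all_algebra.
From mathcomp Require Import all_classical all_reals all_analysis.

Set Implicit Arguments.
Unset Strict Implicit.
Unset Printing Implicit Defensive.

Import Order.TTheory GRing.Theory Num.Theory.
Import numFieldNormedType.Exports.

Local Open Scope classical_set_scope.
Local Open Scope ring_scope.

Definition dotv {R : realType} {n : nat} (u v : 'rV[R]_n) : R :=
  \sum_(i < n) u 0 i * v 0 i.

Definition enorm {R : realType} {n : nat} (u : 'rV[R]_n) : R :=
  Num.sqrt (dotv u u).

Definition grad {R : realType} {n : nat} (f : 'rV[R]_n -> R) (x : 'rV[R]_n) :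
    'rV[R]_n :=
  \row_(i < n) 'D_(delta_mx 0 i) f x.

Definition smooth_convex {R : realType} {n : nat} (L : R)
    (f : 'rV[R]_n -> R) : Prop :=
  [/\ forall x, differentiable f x,
      convex_function [set: convex_lmodType 'rV[R]_n] f &
      forall x y, enorm (grad f x - grad f y) <= L * enorm (x - y)].

Local Open Scope ereal_scope.

Definition edom {R : realType} {n : nat} (phi : 'rV[R]_n -> \bar R) :
    set 'rV[R]_n :=
  [set x | phi x < +oo].

Definition eproper {R : realType} {n : nat} (phi : 'rV[R]_n -> \bar R) : Prop :=
  (forall x, -oo < phi x) /\ edom phi !=set0.

(* Meant for functions that never take the value -oo, so that the right-hand
   side is never +oo - oo; recall 0 * +oo = 0 in \bar R. *)
Definition econvex {R : realType} {n : nat} (phi : 'rV[R]_n -> \bar R) : Prop :=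
  forall (x y : 'rV[R]_n) (t : R), (0 <= t <= 1)%R ->
    phi (t *: x + (1 - t) *: y)%R <= t%:E * phi x + (1 - t)%:E * phi y.

Definition Gamma0 {R : realType} {n : nat} (g : 'rV[R]_n -> \bar R) : Prop :=
  [/\ eproper g, lower_semicontinuous g & econvex g].

Definition Argmin {R : realType} {n : nat} (phi : 'rV[R]_n -> \bar R) :
    set 'rV[R]_n :=
  [set x | forall y, phi x <= phi y].

Definition minval {R : realType} {n : nat} (phi : 'rV[R]_n -> \bar R) : \bar R :=
  ereal_inf (range phi).

(* The argmin is a singleton when lambda > 0 and g is in Gamma0; [xget] selects
   its element (the default 0 is returned only if the argmin is empty). *)
Definition prox {R : realType} {n : nat} (lambda : R) (g : 'rV[R]_n -> \bar R)
    (x : 'rV[R]_n) : 'rV[R]_n :=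
  xget 0%R (Argmin (fun y => g y + ((2 * lambda)^-1 * enorm (y - x) ^+ 2)%:E)).

Definition residual {R : realType} {n : nat} (L : R) (f : 'rV[R]_n -> R)
    (g : 'rV[R]_n -> \bar R) (x : 'rV[R]_n) : 'rV[R]_n :=
  (L *: (x - prox L^-1 g (x - L^-1 *: grad f x)))%R.

Definition fbs {R : realType} {n : nat} (L : R) (f : 'rV[R]_n -> R)
    (g : 'rV[R]_n -> \bar R) (x0 : 'rV[R]_n) (k : nat) : 'rV[R]_n :=
  iter k (fun x => prox L^-1 g (x - L^-1 *: grad f x)%R) x0.

Definition subdiff {R : realType} {n : nat} (phi : 'rV[R]_n -> \bar R)
    (x : 'rV[R]_n) : set 'rV[R]_n :=
  [set v | edom phi x /\ forall y, phi x + (dotv v (y - x)%R)%:E <= phi y].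

Definition crit {R : realType} {n : nat} (phi : 'rV[R]_n -> \bar R) :
    set 'rV[R]_n :=
  [set x | subdiff phi x 0%R].

(* Extended-real valued, so that the distance to the empty set is +oo. *)
Definition dist {R : realType} {n : nat} (x : 'rV[R]_n) (Q : set 'rV[R]_n) :
    \bar R :=
  ereal_inf [set (enorm (x - y)%R)%:E | y in Q].

Definition proj_crit {R : realType} {n : nat} (phi : 'rV[R]_n -> \bar R)
    (x : 'rV[R]_n) : set 'rV[R]_n :=
  [set p | crit phi p /\ forall y, crit phi y -> (enorm (x - p) <= enorm (x - y))%R].

Definition cor_EB {R : realType} {n : nat} (phi : 'rV[R]_n -> \bar R)
    (Res : 'rV[R]_n -> 'rV[R]_n) (nu : R) (Omega : set 'rV[R]_n) : Prop :=
  (0 < nu)%R /\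
  forall x, (Omega `&` edom phi) x ->
    nu%:E * dist x (crit phi) ^+ 2 <=
    ereal_inf [set (dotv (Res x) (x - p)%R)%:E | p in proj_crit phi x].

Definition sublevel {R : realType} {n : nat} (phi : 'rV[R]_n -> \bar R)
    (eps : R) : set 'rV[R]_n :=
  [set x | phi x <= minval phi + eps%:E].

Definition res_tail {R : realType} {n : nat} (Res : 'rV[R]_n -> 'rV[R]_n)
    (x : nat -> 'rV[R]_n) (k : nat) : \bar R :=
  \sum_(0 <= i <oo) (enorm (Res (x (k + i)%N)) ^+ 2)%:E.

(* Main.v *)
Require Import Defs.
From HB Require Import structures.
From mathcomp Require Import all_boot all_order all_algebra.
From mathcomp Require Import all_classical all_reals all_analysis.
From mathcomp Require Import ring lra.
Import Order.TTheory GRing.Theory Num.Theory.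
Import numFieldNormedType.Exports.
Local Open Scope classical_set_scope.
Local Open Scope ring_scope.

(** Write [T x] for the forward-backward step, [R x = L (x - T x)] for the
    residual and [p] for a minimizer of [phi = f + g]. Two inequalities carry the
    whole proof.

    The proximal gradient inequality [prox_grad_ineq],
    [phi (T x) + <R x, y - x> + |R x|^2/(2 L) <= phi y], says at [y = x] that a
    step decreases the value by [|R x|^2/(2 L)], and at [y = p] that the gap after
    the step is at most [<R x, x - p> - |R x|^2/(2 L)].

    Averagedness of the step [residual_dotv_ge],
    [3/(4 L) |R x|^2 <= <R x, x - p>], comes from the cocoercivity of [grad f] and
    the monotonicity of the subdifferential of [g].

    (i) Let [p] be the minimizer nearest to [x]. The error bound
    [nu |x - p|^2 <= <R x, x - p>] and Cauchy-Schwarz give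
    [nu <R x, x - p> <= |R x|^2], so the gap after the step is at most
    [(1/nu - 1/(2 L)) |R x|^2]. The decrease of the value then gives the
    contraction of the gap, and, since the residual series starting at [T x] is at
    most [2 L] times the gap at [T x] by telescoping, the contraction of the
    series. The contraction of the squared distance follows by expanding
    [|T x - p|^2] and using averagedness.

    (ii) If the distance contracts by [sqrt tau], the triangle inequality forces
    [|R x| >= L (1 - sqrt tau) |x - p|], and averagedness turns this into the
    error bound.

    The analytic background is the existence of proximal points and of nearest
    minimizers, both from the attainment of the minimum of a lower semicontinuous
    function on a compact set, and the first-order inequalities for [f]. *)

(** * Euclidean inner product and norm *)

Section euclidean.
Context {R : realType} {n : nat}.
Implicit Types u v w : 'rV[R]_n.

Lemma dotvC u v : dotv u v = dotv v u.
Proof. by apply: eq_bigr => i _; rewrite mulrC. Qed.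

Lemma dotvDl u v w : dotv (u + v) w = dotv u w + dotv v w.
Proof. by rewrite -big_split; apply: eq_bigr => i _; rewrite mxE mulrDl. Qed.

Lemma dotvZl a u v : dotv (a *: u) v = a * dotv u v.
Proof. by rewrite /dotv mulr_sumr; apply: eq_bigr => i _; rewrite mxE mulrA. Qed.

Lemma dotvNl u v : dotv (- u) v = - dotv u v.
Proof. by rewrite -scaleN1r dotvZl mulN1r. Qed.

Lemma dotvDr u v w : dotv u (v + w) = dotv u v + dotv u w.
Proof. by rewrite dotvC dotvDl !(dotvC u). Qed.

Lemma dotvZr a u v : dotv u (a *: v) = a * dotv u v.
Proof. by rewrite dotvC dotvZl dotvC. Qed.

Lemma dotvNr u v : dotv u (- v) = - dotv u v.
Proof. by rewrite dotvC dotvNl dotvC. Qed.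

Definition dotvE := (dotvDl, dotvDr, dotvNl, dotvNr, dotvZl, dotvZr).

Lemma dotvv_ge0 u : 0 <= dotv u u.
Proof. by apply: sumr_ge0 => i _; rewrite -expr2 sqr_ge0. Qed.

Lemma enorm_ge0 u : 0 <= enorm u.
Proof. exact: sqrtr_ge0. Qed.

Lemma enorm_sqr u : enorm u ^+ 2 = dotv u u.
Proof. by rewrite sqr_sqrtr // dotvv_ge0. Qed.

Lemma enormN u : enorm (- u) = enorm u.
Proof. by rewrite /enorm !dotvE opprK. Qed.

Lemma enormZ {a u} : 0 <= a -> enorm (a *: u) = a * enorm u.
Proof.
move=> a0; rewrite /enorm !dotvE mulrA -expr2 sqrtrM ?sqr_ge0 //.
by rewrite sqrtr_sqr ger0_norm.
Qed.

Lemma coord_le_enorm u i : `|u 0 i| <= enorm u.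
Proof.
rewrite -(@ler_pXn2r _ 2) ?nnegrE ?enorm_ge0 //.
rewrite enorm_sqr real_normK ?num_real // /dotv (bigD1 i) //= -expr2 lerDl.
by apply: sumr_ge0 => j _; rewrite -expr2 sqr_ge0.
Qed.

(** The topology comes from the sup norm; this bound turns Euclidean estimates
    into boundedness for that norm. *)
Lemma mx_norm_le_enorm u : `|u| <= enorm u.
Proof.
rewrite [leLHS]/Num.norm /= mx_normrE; apply: bigmax_le; first exact: enorm_ge0.
by move=> [i j] _ /=; rewrite (ord1 i) coord_le_enorm.
Qed.

Lemma enorm0_eq0 u : enorm u = 0 -> u = 0.
Proof.
move=> u0; apply/rowP => i; rewrite mxE; apply/eqP.
by rewrite -normr_eq0 eq_le normr_ge0 andbT -u0 coord_le_enorm.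
Qed.

(** Cauchy-Schwarz: expand the square of [|v| u - |u| v]. *)
Lemma dotv_le_enorm u v : dotv u v <= enorm u * enorm v.
Proof.
have [/enorm0_eq0->|u0] := eqVneq (enorm u) 0.
  by rewrite -(scale0r 0) dotvZl mul0r mulr_ge0 ?enorm_ge0.
have [/enorm0_eq0->|v0] := eqVneq (enorm v) 0.
  by rewrite -(scale0r 0) dotvZr mul0r mulr_ge0 ?enorm_ge0.
have := dotvv_ge0 (enorm v *: u - enorm u *: v).
rewrite !dotvE (dotvC v u) -!enorm_sqr.
have : 0 < enorm u * enorm v by rewrite mulr_gt0 // lt0r enorm_ge0 ?u0 ?v0.
nra.
Qed.

Lemma enormD u v : enorm (u + v) <= enorm u + enorm v.
Proof.
rewrite -(@ler_pXn2r _ 2) ?nnegrE ?addr_ge0 ?enorm_ge0 //.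
rewrite enorm_sqr !dotvE (dotvC v u) -!enorm_sqr.
have := dotv_le_enorm u v; lra.
Qed.

Lemma enormB u v : enorm (u - v) = enorm (v - u).
Proof. by rewrite -enormN opprB. Qed.

Lemma enorm_sqr_continuous w : continuous (fun u => enorm (u - w)^+2).
Proof.
have cw i : continuous (fun u => (u - w) 0 i).
  have -> : (fun u => (u - w) 0 i) = (fun u => u 0 i - w 0 i).
    by apply/funext => u; rewrite !mxE.
  by move=> u; apply: (cvgB (@coord_continuous R 1 n 0 i u)); exact: cvg_cst.
have -> : (fun u => enorm (u - w) ^+ 2) =
    (fun u => \sum_(i < n) (u - w) 0 i * (u - w) 0 i).
  by apply/funext => u; rewrite enorm_sqr.
apply: continuous_big => [|i _ u]; first exact: add_continuous.
exact: (continuousM (cw i u) (cw i u)).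
Qed.
End euclidean.

(** * Convex functions with Lipschitz gradient *)

Section gradient.
Context {R : realType} {n : nat} {f : 'rV[R]_n -> R}.

Lemma derive_grad x v : differentiable f x -> 'D_v f x = dotv (grad f x) v.
Proof.
move=> df; rewrite deriveE // [in LHS](row_sum_delta v) linear_sum.
by apply: eq_bigr => i _; rewrite linearZ /= mxE deriveE // mulrC.
Qed.

(** Reduces the descent lemma to one variable, where the mean value theorem
    applies. *)
Lemma is_derive_line x v t : differentiable f (x + t *: v) ->
  is_derive t 1 (fun s => f (x + s *: v)) (dotv (grad f (x + t *: v)) v).
Proof.
move=> df; rewrite -derive_grad //.
have E : (fun h : R => h^-1 *: (((fun s => f (x + s *: v)) \o shift t) (h *: 1)
   - f (x + t *: v))) =
  (fun h => h^-1 *: ((f \o shift (x + t *: v)) (h *: v) - f (x + t *: v))).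
  apply/funext => h /=; congr (_ *: (f _ - _)).
  by rewrite [h%:A](mulr1) scalerDl addrCA.
have dv : derivable f (x + t *: v) v by exact: diff_derivable.
by split; rewrite /derivable /derive E.
Qed.

Hypothesis df : forall x, differentiable f x.

(** By convexity the difference quotient of [f] at [x] towards [y] is at most
    [f y - f x] for steps in [(0, 1]]; its limit is the directional
    derivative. *)
Lemma convex_gradient_le x y :
  convex_function [set: convex_lmodType 'rV[R]_n] f ->
  f x + dotv (grad f x) (y - x) <= f y.
Proof.
move=> cf; rewrite -derive_grad // -lerBrDl.
have dv : derivable f x (y - x) by exact: diff_derivable.
apply: (cvgr_to_le (cvg_dnbhs_at_right dv)).
near=> h.
have h0 : 0 < h by near: h; exact: nbhs_right_gt.
have h1 : h <= 1 by near: h; exact: nbhs_right_le.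
have := cf (Itv01 (ltW h0) h1) y x (in_setT _) (in_setT _).
rewrite convRE /conv /= /unstable.onem => H.
rewrite /GRing.scale /= mulrC ler_pdivrMr //.
rewrite (_ : h *: (y - x) + x = h *: y + (1 - h) *: x); first by lra.
by rewrite scalerBr scalerBl scale1r addrAC addrA.
Unshelve. all: by end_near. Qed.

(** Along the segment, [f] minus its quadratic upper model at [x] has a
    nonpositive derivative, because the gradient drifts by at most [L t |y - x|]
    after time [t]; the mean value theorem concludes. *)
Lemma descent_lemma {L : R} :
  (forall x y, enorm (grad f x - grad f y) <= L * enorm (x - y)) ->
  forall x y, f y <= f x + dotv (grad f x) (y - x) + L / 2 * enorm (y - x) ^+ 2.
Proof.
move=> Lip x y; set v := y - x.
pose h := fun t : R => f (x + t *: v) - (t * dotv (grad f x) v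
   + t ^+ 2 * (L / 2 * enorm v ^+ 2)).
have dh (t : R) : is_derive t 1 h (dotv (grad f (x + t *: v)) v
    - (dotv (grad f x) v + 2 * t * (L / 2 * enorm v ^+ 2))).
  apply: is_deriveB; first exact: is_derive_line.
  apply: is_derive_eq; rewrite /GRing.scale /=; ring.
have [|c] := @MVT R h _ 0 1 ltr01 (fun t _ => dh t).
  apply: derivable_within_continuous => t _; exact: ex_derive.
rewrite in_itv /= => /andP[c0 c1].
rewrite /h scale1r scale0r addr0 expr1n !mul1r expr0n !mul0r addr0 subr0 subr0.
rewrite mulr1.
rewrite (_ : x + v = y); last by rewrite /v addrC subrK.
have : dotv (grad f (x + c *: v) - grad f x) v <= L * (c * enorm v) * enorm v.
  apply: le_trans (dotv_le_enorm _ _) _; rewrite ler_wpM2r ?enorm_ge0 //.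
  by apply: le_trans (Lip _ _) _; rewrite addrC addKr enormZ // ltW.
rewrite !dotvE; lra.
Qed.

(** Sharpened gradient inequality. Compare at the point reached from [y] by a
    step [1/L] along [grad f x - grad f y]: the tangent plane at [x] bounds [f]
    there from below, the descent lemma at [y] bounds it from above. *)
Lemma convex_gradient_sqr_le {L : R} x y : 0 < L ->
  convex_function [set: convex_lmodType 'rV[R]_n] f ->
  (forall x y, enorm (grad f x - grad f y) <= L * enorm (x - y)) ->
  f x + dotv (grad f x) (y - x) + (2 * L)^-1 * enorm (grad f y - grad f x) ^+ 2
    <= f y.
Proof.
move=> L0 cf Lip; set w := grad f y - grad f x.
have lo := convex_gradient_le x (y - L^-1 *: w) cf.
have up := descent_lemma Lip y (y - L^-1 *: w).
move: lo up; set z := y - L^-1 *: w.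
have -> : z - y = - (L^-1 *: w) by rewrite /z addrAC subrr add0r.
have -> : z - x = (y - x) - L^-1 *: w by rewrite /z addrAC.
have ww : dotv w w = dotv (grad f y) w - dotv (grad f x) w.
  by rewrite /w dotvDl dotvNl.
have k0 : 0 <= L^-1 by rewrite invr_ge0 ltW.
rewrite enormN enormZ // exprMn enorm_sqr.
rewrite !(dotvDr _ (y - x)) !dotvNr !dotvZr ww.
have -> : L / 2 * (L^-1 ^+ 2 * (dotv (grad f y) w - dotv (grad f x) w)) =
    L^-1 / 2 * (dotv (grad f y) w - dotv (grad f x) w).
  by field; rewrite gt_eqF.
rewrite invfM; lra.
Qed.

(** Baillon-Haddad: add the sharpened gradient inequalities at [(x, y)] and
    [(y, x)]. *)
Lemma gradient_cocoercive {L : R} x y : 0 < L ->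
  convex_function [set: convex_lmodType 'rV[R]_n] f ->
  (forall x y, enorm (grad f x - grad f y) <= L * enorm (x - y)) ->
  L^-1 * enorm (grad f x - grad f y) ^+ 2 <= dotv (grad f x - grad f y) (x - y).
Proof.
move=> L0 cf Lip.
have := convex_gradient_sqr_le x y L0 cf Lip.
have := convex_gradient_sqr_le y x L0 cf Lip.
rewrite (enormB (grad f y)) -(opprB x y) dotvNr dotvDl dotvNl invfM; lra.
Qed.
End gradient.

Local Open Scope ereal_scope.

(** * Minimization of lower semicontinuous functions *)

Lemma ereal_dense {R : realType} (a b : \bar R) :
  a < b -> exists r : R, a < r%:E < b.
Proof.
case: a b => [r||] [s||] //.
- rewrite lte_fin => rs; exists ((r + s) / 2)%R; rewrite !lte_fin; lra.
- by move=> _; exists (r + 1)%R; rewrite lte_fin ltry andbT; lra.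
- by move=> _; exists (s - 1)%R; rewrite lte_fin ltNyr /=; lra.
- by move=> _; exists 0%R; rewrite ltNyr ltry.
Qed.

(** The strict sublevel sets of [h] above its infimum [m] over [A] generate a
    proper filter on [A]; semicontinuity forces [h c <= m] at any cluster
    point [c]. *)
Lemma lsc_compact_min {T : topologicalType} {R : realType} {h : T -> \bar R}
    {A : set T} :
  compact A -> A !=set0 -> lower_semicontinuous h ->
  exists2 c, A c & forall t, A t -> h c <= h t.
Proof.
move=> cA [x0 Ax0] lsch; pose m := ereal_inf (h @` A).
have mh t : A t -> m <= h t by move=> At; apply: ereal_inf_lbound; exists t.
suff [c Ac hcm] : exists2 c, A c & h c <= m.
  by exists c => // t At; apply: le_trans (mh _ At).
have [mx0|mx0] := leP (h x0) m; first by exists x0.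
pose F := filter_from [set a | m < a] (fun a => A `&` [set y | h y < a]).
have FF : ProperFilter F.
  apply: filter_from_proper.
    apply: filter_from_filter; first by exists (h x0).
    move=> a b ma mb; exists (mine a b); first by rewrite /= lt_min ma.
    by move=> y [Ay /=]; rewrite lt_min => /andP[].
  by move=> a /ereal_inf_lt[_ [y Ay <-] hya]; exists y.
have FA : F A by exists (h x0) => // y [].
have [c [Ac cFc]] := cA F FF FA; exists c => //.
rewrite leNgt; apply/negP => /ereal_dense[a /andP[ma /lsch[V Vc Va]]].
have [y [[_ /= ya] Vy]] : (A `&` [set y | h y < a%:E]) `&` V !=set0.
  by apply: cFc => //; exists a%:E.
by have := lt_trans ya (Va _ Vy); rewrite ltxx.
Qed.

Lemma lsc_closed_sublevel {T : topologicalType} {R : realType} {h : T -> \bar R}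
    {b : \bar R} : lower_semicontinuous h -> closed [set x | h x <= b].
Proof.
move=> lsch x xcl /=; rewrite leNgt; apply/negP.
move=> /ereal_dense[a /andP[ba /lsch[V Vx Va]]].
have [y [/= yb Vy]] := xcl _ Vx.
by have := lt_trans (le_lt_trans yb ba) (Va _ Vy); rewrite ltxx.
Qed.

(** The value [-oo] of [h] is harmless: the sum is then [-oo], above no real. *)
Lemma lscD_continuous {T : topologicalType} {R : realType} {h : T -> \bar R}
    {q : T -> R} : lower_semicontinuous h -> continuous q ->
  lower_semicontinuous (fun x => (q x)%:E + h x).
Proof.
move=> lsch cq x a ax.
have [b] : exists b : R, (a - b)%:E < (q x)%:E /\ b%:E < h x.
  have : (a - q x)%:E < h x by rewrite EFinB lteBlDl.
  move=> /ereal_dense[b /andP[+ bh]]; rewrite lte_fin => ab.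
  by exists b; split=> //; rewrite lte_fin; lra.
rewrite lte_fin => -[aq /lsch[V Vx Vb]].
exists (V `&` [set y | (a - b < q y)%R]).
  by apply: filterI => //; exact: (cvgr_gt (q x) (cq x)).
move=> y [/Vb by_ /= aqy].
by rewrite (_ : a = (a - b) + b)%R ?EFinD ?lteD //; lra.
Qed.

Lemma lsc_bounded_Argmin {R : realType} {n : nat} {h : 'rV[R]_n -> \bar R}
    {x0 : 'rV[R]_n} :
  lower_semicontinuous h -> bounded_set [set y | h y <= h x0] ->
  Argmin h !=set0.
Proof.
move=> lsch bh.
have [||c cx0 hc] := lsc_compact_min (A := [set y | h y <= h x0]) _ _ lsch.
- by apply: bounded_closed_compact => //; apply: lsc_closed_sublevel.
- by exists x0 => /=.
exists c => y; have [/hc//|/ltW yx0] := leP (h y) (h x0).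
exact: le_trans yx0.
Qed.

(** * First-order optimality and proximal points *)

Section first_order.
Context {R : realType} {n : nat}.
Implicit Types (g : 'rV[R]_n -> \bar R) (p v x y z : 'rV[R]_n).

Lemma le0_of_le_small_multiples (a b : R) :
  (forall t, 0 < t <= 1 -> a <= t * b)%R -> (a <= 0)%R.
Proof.
move=> H; rewrite leNgt; apply/negP => a0.
have ab : (a <= b)%R by rewrite -(mul1r b) H // ltr01 lexx.
have b0 : (0 < b)%R by lra.
(* At [t = a / (2 b)] the hypothesis reads [a <= a / 2]. *)
have := H (a / (2 * b))%R.
rewrite divr_gt0 ?mulr_gt0 //= ler_pdivrMr ?mulr_gt0 // mul1r.
rewrite (_ : a / (2 * b) * b = a / 2)%R; last by field; rewrite gt_eqF.
move=> /(_ ltac:(lra)); lra.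
Qed.

(** First-order optimality without assuming [h] differentiable: a quadratic upper
    model of [h] with slope [v] suffices. Comparing [p] with [t y + (1 - t) p]
    and using convexity of [g] gives the subgradient inequality up to an error
    [t M |y - p|^2], and [t] tends to 0. *)
Lemma Argmin_subdiff {g} {h : 'rV[R]_n -> R} {p v} {M : R} :
  econvex g -> (forall y, -oo < g y) -> g p < +oo ->
  (forall y, h y <= h p + dotv v (y - p) + M * enorm (y - p) ^+ 2)%R ->
  Argmin (fun y => (h y)%:E + g y) p ->
  forall y, g p + (dotv (- v) (y - p))%:E <= g y.
Proof.
move=> cg gNy gp hM pmin y.
case gyE : (g y) (gNy y) => [r||] //; last by rewrite leey.
case gpE : (g p) (gNy p) gp => [s||] // _ _ _.
rewrite -EFinD lee_fin dotvNl.
suff : (s - dotv v (y - p) - r <= 0)%R by lra.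
apply: (@le0_of_le_small_multiples _ (M * enorm (y - p) ^+ 2)) => t /andP[t0 t1].
have := cg y p t; rewrite (ltW t0) t1 => /(_ isT).
set z := (t *: y + (1 - t) *: p)%R; rewrite gyE gpE -!EFinM -EFinD.
have := pmin z => /=; rewrite gpE.
case: (g z) (gNy z) => [q||] // _; rewrite -!EFinD !lee_fin.
have zp : (z - p = t *: (y - p))%R.
  by rewrite /z scalerBl scale1r scalerBr (addrC p) addrA addrK.
have := hM z; rewrite zp (enormZ (ltW t0)) dotvZr exprMn => h1 h2 h3.
rewrite -(ler_pM2l t0); lra.
Qed.

(** The proximal subproblem has a solution because [g] has an affine minorant,
    so adding the quadratic makes sublevel sets bounded. The minorant is
    supplied as a subgradient [v] at a point [p]: for the problem at hand, a
    minimizer of [f + g] provides one, which avoids a separation theorem. *)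
Lemma prox_Argmin {g} {lam : R} {p v} z :
  (0 < lam)%R -> lower_semicontinuous g -> (forall y, -oo < g y) ->
  g p < +oo -> (forall y, g p + (dotv v (y - p))%:E <= g y) ->
  Argmin (fun y => ((2 * lam)^-1 * enorm (y - z) ^+ 2)%:E + g y)
    (prox lam g z).
Proof.
move=> lam0 lscg gNy gp gv.
have -> : (fun y => ((2 * lam)^-1 * enorm (y - z) ^+ 2)%:E + g y) =
    (fun y => g y + ((2 * lam)^-1 * enorm (y - z) ^+ 2)%:E).
  by apply/funext => y; rewrite addeC.
suff H : Argmin (fun y => g y + ((2 * lam)^-1 * enorm (y - z) ^+ 2)%:E) !=set0.
  by case: H => c Hc; exact: (xgetPex 0%R (ex_intro _ c Hc)).
set h := fun y => _; set k := ((2 * lam)^-1)%R.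
have k0 : (0 < k)%R by rewrite invr_gt0 mulr_gt0.
apply: (lsc_bounded_Argmin (x0 := p)).
  have -> : h = (fun y => (k * enorm (y - z) ^+ 2)%:E + g y).
    by apply/funext => y; rewrite /h addeC.
  apply: lscD_continuous => // y.
  exact: (continuousM (@cst_continuous _ _ k _) (enorm_sqr_continuous z y)).
case gpE : (g p) (gNy p) gp => [s||] // _ _.
(* On the sublevel set of [h] at [p], [e := |y - z|] satisfies
   [k e^2 <= b + |v| e], whence [e <= max 1 ((b + |v|) / k)]. *)
pose B := (`|k * enorm (p - z) ^+ 2 - dotv v (z - p)| + enorm v)%R.
exists (1 + B / k + enorm z)%R; split; first exact: num_real.
move=> M BM y /=; rewrite /h gpE => yp.
apply: le_trans (mx_norm_le_enorm _) _; apply: ltW; apply: le_lt_trans BM.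
rewrite -{1}(subrK z y); apply: le_trans (enormD _ _) _; rewrite lerD2r.
have [|e1] := leP (enorm (y - z)) 1%R.
  by move/le_trans; apply; rewrite lerDl divr_ge0 ?addr_ge0 ?enorm_ge0 // ltW.
suff : (enorm (y - z) <= B / k)%R by lra.
rewrite ler_pdivlMr //.
have : (s + dotv v (y - p) + k * enorm (y - z) ^+ 2 <=
        s + k * enorm (p - z) ^+ 2)%R.
  rewrite -lee_fin !EFinD; apply: le_trans yp; rewrite leeD2r //.
  by have := gv y; rewrite gpE.
have -> : dotv v (y - p) = (dotv v (y - z) + dotv v (z - p))%R.
  by rewrite -dotvDr addrA subrK.
have := dotv_le_enorm (- v) (y - z); rewrite dotvNl enormN.
have := ler_norm (k * enorm (p - z) ^+ 2 - dotv v (z - p)).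
have := enorm_ge0 v.
rewrite /B; set b := `|_|%R; set e := enorm (y - z); set w := enorm v.
move=> w0 hb h1 h2.
have b0 : (0 <= b)%R by exact: normr_ge0.
have be : (b <= b * e)%R by rewrite ler_peMr // ltW.
have : (k * e * e <= (b + w) * e)%R by lra.
by rewrite ler_pM2r ?(lt_trans _ e1) // mulrC addrC; lra.
Qed.

(** First-order optimality in the proximal subproblem: the quadratic
    [L/2 |y - z|^2] has slope [L (q - z)] at [q] and is its own quadratic
    model. *)
Lemma prox_subdiff {g} {L : R} {p v} z (q := prox L^-1 g z) :
  (0 < L)%R -> Gamma0 g ->
  g p < +oo -> (forall y, g p + (dotv v (y - p))%:E <= g y) ->
  g q < +oo /\ forall y, g q + (dotv (L *: (z - q))%R (y - q)%R)%:E <= g y.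
Proof.
move=> L0 [[gNy _] lscg cg] gp gv.
have Lv0 : (0 < L^-1)%R by rewrite invr_gt0.
have qmin : Argmin _ q := prox_Argmin z Lv0 lscg gNy gp gv.
have gq : g q < +oo.
  have := qmin p; case: (g p) (gNy p) gp => [s||] // _ _.
  by case: (g q) => [r _||] //; rewrite ltry.
split=> // y.
have -> : (L *: (z - q) = - (L *: (q - z)))%R by rewrite -scalerN opprB.
apply: (Argmin_subdiff (M := L / 2) cg gNy gq _ qmin) => {}y.
rewrite invfM invrK.
have -> : (y - z = (y - q) + (q - z))%R by rewrite addrA subrK.
rewrite !enorm_sqr dotvZl; move: (y - q)%R (q - z)%R => a b.
by rewrite dotvDl !dotvDr (dotvC a b); lra.
Qed.

End first_order.

(** * Nearest points, distances and series *)

Section nearest_point.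
Context {R : realType} {n : nat}.
Implicit Types (phi : 'rV[R]_n -> \bar R) (x p : 'rV[R]_n).

Lemma crit_Argmin {phi} : edom phi !=set0 -> crit phi = Argmin phi.
Proof.
move=> [x0 x0d]; have d0 w : dotv (0 : 'rV[R]_n) w = 0%R.
  by rewrite -(scale0r 0%R) dotvZl mul0r.
apply/seteqP; split=> x.
  by move=> [_ Hx] y; have := Hx y; rewrite d0 adde0.
move=> Hx; split; first exact: le_lt_trans (Hx x0) x0d.
by move=> y; rewrite d0 adde0; exact: Hx.
Qed.

(** Points of [C] farther from [x] than some fixed [c] in [C] are irrelevant, and
    the others form a compact set. *)
Lemma nearest_point_exists {C : set 'rV[R]_n} x : closed C -> C !=set0 ->
  exists2 p, C p & forall y, C y -> (enorm (x - p) <= enorm (x - y))%R.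
Proof.
move=> Ccl [c Cc].
pose h y := (enorm (y - x) ^+ 2)%:E; pose A := C `&` [set y | h y <= h c].
have lsch : lower_semicontinuous h.
  move=> y a; rewrite lte_fin => ay.
  exists [set z | (a < enorm (z - x) ^+ 2)%R].
    exact: (cvgr_gt _ (enorm_sqr_continuous x y)).
  by move=> z /=; rewrite /h lte_fin.
have le_h y z : (h y <= h z) = (enorm (x - y) <= enorm (x - z))%R.
  by rewrite lee_fin ler_pXn2r ?nnegrE ?enorm_ge0 // !(enormB x).
have cA : compact A.
  apply: bounded_closed_compact.
    exists (enorm (x - c) + enorm x)%R; split; first exact: num_real.
    move=> M cM y [_ /=]; rewrite le_h => yc.
    apply: le_trans (mx_norm_le_enorm _) _; apply: ltW; apply: le_lt_trans cM.
    rewrite -{1}(subrK x y); apply: le_trans (enormD _ _) _.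
    by move: yc; rewrite (enormB x y) lerD2r.
  by apply: closedI => //; exact: (lsc_closed_sublevel lsch).
have [|p [Cp _] pmin] := lsc_compact_min cA _ lsch.
  by exists c; split=> //=; rewrite /= lexx.
exists p => // y Cy; rewrite -le_h; have [yc|/ltW cy] := leP (h y) (h c).
  by apply: pmin; split.
by apply: le_trans cy; apply: pmin; split=> //=; rewrite /= lexx.
Qed.

Lemma dist_nearest_point {C : set 'rV[R]_n} {x p} : C p ->
  (forall y, C y -> (enorm (x - p) <= enorm (x - y))%R) ->
  dist x C = (enorm (x - p))%:E.
Proof.
move=> Cp pmin; apply/eqP; rewrite eq_le; apply/andP; split.
  by apply: ereal_inf_lbound; exists p.
by apply: le_ereal_inf_tmp => _ [y Cy <-]; rewrite lee_fin pmin.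
Qed.

End nearest_point.

Lemma nneseries_EFin_le {R : realType} (a : nat -> R) (B : R) :
  (forall i, 0 <= a i)%R -> (forall N, \sum_(0 <= i < N) a i <= B)%R ->
  \sum_(0 <= i <oo) (a i)%:E <= B%:E.
Proof.
move=> a0 aB; apply: lime_le.
  by apply: is_cvg_nneseries => i _ _; rewrite lee_fin.
by apply: nearW => N; rewrite sumEFin lee_fin.
Qed.

(** * The forward-backward step *)

Section forward_backward.
Context {R : realType} {n : nat} {L : R} {f : 'rV[R]_n -> R}.
Context {g : 'rV[R]_n -> \bar R}.
Hypotheses (L0 : (0 < L)%R) (hf : smooth_convex L f) (hg : Gamma0 g).
Let phi := fun x => (f x)%:E + g x.
Hypothesis hmin : Argmin phi !=set0.
Let T x := prox L^-1 g (x - L^-1 *: grad f x)%R.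
Let Res := residual L f g.
Implicit Types (x y p : 'rV[R]_n).

Let gNy y : -oo < g y. Proof. by case: hg => -[]. Qed.

Lemma dom_phi : edom phi !=set0.
Proof.
case: hg => -[_ [x0 x0d]] _ _; exists x0.
by rewrite /edom /phi /= lte_add_pinfty // ltry.
Qed.

Lemma phi_real {x} : phi x < +oo -> phi x = (fine (phi x))%:E.
Proof.
rewrite /phi; case: (g x) (gNy x) => [r||] //; by rewrite addey ?ltxx.
Qed.

Lemma Argmin_real {p} : Argmin phi p -> phi p < +oo.
Proof. by case: dom_phi => x0 x0d pmin; exact: le_lt_trans (pmin x0) x0d. Qed.

Lemma Argmin_g {p} : Argmin phi p -> g p < +oo.
Proof. by move/Argmin_real; rewrite /phi; case: (g p) => [r _||] //; rewrite ltry. Qed.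

(** This is [0 \in grad f p + subdiff g p] for a minimizer [p]; it also serves
    as the affine minorant of [g] that makes the proximal map well defined. *)
Lemma Argmin_grad_subdiff {p} y : Argmin phi p ->
  g p + (dotv (- grad f p) (y - p))%:E <= g y.
Proof.
move=> pmin; case: hf => df cf Lip; case: hg => _ _ cg.
apply: (Argmin_subdiff (M := L / 2) cg gNy (Argmin_g pmin) _ pmin) => {}y.
exact: descent_lemma.
Qed.

(** With [z := x - L^-1 grad f x], the subgradient [L (z - T x)] of [g] at
    [T x] is [Res x - grad f x]. *)
Lemma residual_subdiff x : g (T x) < +oo /\ forall y,
  g (T x) + (dotv (Res x - grad f x) (y - T x))%:E <= g y.
Proof.
case: hmin => p pmin.
have := prox_subdiff (x - L^-1 *: grad f x)%R L0 hg (Argmin_g pmin)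
  (fun y => Argmin_grad_subdiff y pmin).
by rewrite -/(T x) addrAC scalerBr scalerA mulfV ?gt_eqF // scale1r.
Qed.

Lemma fb_step_residualE x : T x = (x - L^-1 *: Res x)%R.
Proof. by rewrite /Res /residual scalerA mulVf ?gt_eqF // scale1r subKr. Qed.

(** Sum of three bounds: the tangent plane of [f] at [x] below [f y], the descent
    lemma from [x] to [T x], and the subgradient inequality of [g] at [T x]. *)
Lemma prox_grad_ineq x y :
  phi (T x) + (dotv (Res x) (y - x) + (2 * L)^-1 * enorm (Res x) ^+ 2)%:E
  <= phi y.
Proof.
case: hf => df cf Lip; have [gT /(_ y)] := residual_subdiff x; rewrite /phi.
case: (g y) (gNy y) => [r||] // _; last by rewrite addey ?leey.
case: (g (T x)) (gNy (T x)) gT => [s||] // _ _; rewrite -!EFinD !lee_fin.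
have := convex_gradient_le df x y cf.
have := descent_lemma df Lip x (T x).
have -> : (y - T x = (y - x) + L^-1 *: Res x)%R.
  by rewrite fb_step_residualE opprB addrA addrAC.
have -> : (T x - x = - (L^-1 *: Res x))%R by rewrite fb_step_residualE addrAC subrr add0r.
have Lv0 : (0 <= L^-1)%R by rewrite invr_ge0 ltW.
rewrite enormN (enormZ Lv0) exprMn enorm_sqr.
move: (y - x)%R (Res x) => a b; rewrite !dotvE.
have -> : (L / 2 * (L^-1 ^+ 2 * dotv b b) = (L^-1 / 2 * dotv b b))%R.
  by field; rewrite gt_eqF.
rewrite invfM; lra.
Qed.

(** The step is 2/3-averaged, and this is that property in terms of the residual.
    With [w := grad f x - grad f p], monotonicity of the subdifferential of [g]
    gives [0 <= <Res x - w, (x - p) - L^-1 Res x>]; cocoercivity gives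
    [L^-1 |w|^2 <= <w, x - p>]; what remains is the square of [2 w - Res x].
    The constant [3/4] (where the function values alone would give [1/2]) is what
    makes the squared distance contract. *)
Lemma residual_dotv_ge x {p} : Argmin phi p ->
  (3 / (4 * L) * enorm (Res x) ^+ 2 <= dotv (Res x) (x - p))%R.
Proof.
move=> pmin; case: hf => df cf Lip.
have := gradient_cocoercive df x p L0 cf Lip.
have [gT /(_ p)] := residual_subdiff x.
have := Argmin_grad_subdiff (T x) pmin.
case: (g (T x)) (gNy (T x)) gT => [s||] // _ _.
case: (g p) (gNy p) (Argmin_g pmin) => [r||] // _ _.
rewrite -!EFinD !lee_fin.
have -> : (p - T x = L^-1 *: Res x - (x - p))%R.
  by rewrite fb_step_residualE !opprB addrCA addrC.
have -> : (T x - p = (x - p) - L^-1 *: Res x)%R by rewrite fb_step_residualE addrAC.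
set w := (grad f x - grad f p)%R => h1 h2 h3.
have h4 : (0 <= dotv (Res x - w) ((x - p) - L^-1 *: Res x))%R.
  move: h1 h2; rewrite /w; move: (x - p)%R (Res x) => a b.
  by rewrite !dotvE; lra.
have := dotvv_ge0 (2 *: w - Res x); move: h3 h4; rewrite !enorm_sqr.
move: (x - p)%R (Res x) w => a b w; rewrite !dotvE (dotvC b w).
rewrite (_ : 3 / (4 * L) = 3 / 4 * L^-1)%R; last by field; rewrite gt_eqF.
move=> h3 h4 h5; have Lv0 : (0 <= L^-1)%R by rewrite invr_ge0 ltW.
have := mulr_ge0 Lv0 h5; lra.
Qed.

(** [Argmin phi] is a sublevel set of the lower semicontinuous [phi]. *)
Lemma Argmin_closed : closed (Argmin phi).
Proof.
case: hmin => p pmin; case: hf => df _ _; case: hg => _ lscg _.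
have -> : Argmin phi = [set x | phi x <= phi p].
  by apply/seteqP; split=> x; [exact|move=> xp y; exact: le_trans (pmin y)].
apply: lsc_closed_sublevel; apply: lscD_continuous => // x.
exact: differentiable_continuous.
Qed.

Lemma proj_crit_exists x : exists p, proj_crit phi x p.
Proof.
have [p pmin px] := nearest_point_exists x Argmin_closed hmin.
by exists p; rewrite /proj_crit /= crit_Argmin //; exact: dom_phi.
Qed.

Lemma dist_Argmin {x p} : proj_crit phi x p ->
  dist x (Argmin phi) = (enorm (x - p))%:E.
Proof.
case; rewrite (crit_Argmin dom_phi); exact: dist_nearest_point.
Qed.

Lemma minvalE {p} : Argmin phi p -> minval phi = phi p.
Proof.
move=> pmin; apply/eqP; rewrite eq_le; apply/andP; split.
  by apply: ereal_inf_lbound; exists p.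
by apply: le_ereal_inf_tmp => _ [y _ <-]; exact: pmin.
Qed.

Local Notation F x := (fine (phi x)).

Lemma phi_T_fin x : phi (T x) < +oo.
Proof.
have [gT _] := residual_subdiff x; rewrite /phi.
by case: (g (T x)) gT => [r||] // _; rewrite ltry.
Qed.

(** The proximal gradient inequality at [y = x]. *)
Lemma residual_sqr_le_decrease {x} : phi x < +oo ->
  ((2 * L)^-1 * enorm (Res x) ^+ 2 <= F x - F (T x))%R.
Proof.
move=> px; have := prox_grad_ineq x x.
rewrite (phi_real px) (phi_real (phi_T_fin x)) -EFinD lee_fin.
by rewrite subrr -(scale0r 0%R) dotvZr mul0r; lra.
Qed.

(** The proximal gradient inequality at a minimizer [y = p]. *)
Lemma gap_le_dotv_residual x {p} : Argmin phi p ->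
  (F (T x) - F p <= dotv (Res x) (x - p) - (2 * L)^-1 * enorm (Res x) ^+ 2)%R.
Proof.
move=> pmin; have := prox_grad_ineq x p.
rewrite (phi_real (Argmin_real pmin)) (phi_real (phi_T_fin x)) -EFinD lee_fin.
by rewrite -(opprB x p) dotvNr; lra.
Qed.

(** * Consequences of the error bound along one step *)

Section error_bound_step.
Context {nu : R} {x p : 'rV[R]_n}.
Hypotheses (nu0 : (0 < nu)%R) (pmin : Argmin phi p).
Hypothesis EB : (nu * enorm (x - p) ^+ 2 <= dotv (Res x) (x - p))%R.

(** By Cauchy-Schwarz the error bound gives [nu |x - p| <= |Res x|], hence
    [nu <Res x, x - p> <= |Res x|^2]; insert this in the bound of the gap by
    [<Res x, x - p>]. *)
Lemma gap_le_residual_sqr :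
  (nu * (F (T x) - F p) <= (1 - nu / (2 * L)) * enorm (Res x) ^+ 2)%R.
Proof.
have := gap_le_dotv_residual x pmin.
have := dotv_le_enorm (Res x) (x - p).
move: EB (enorm_ge0 (x - p)) (enorm_ge0 (Res x)).
set c := dotv _ _; set s := enorm (x - p); set r := enorm (Res x).
move=> cs s0 r0 cr H.
have ncr : (nu * c <= r ^+ 2)%R.
  have [s00|s00] := eqVneq s 0%R.
    rewrite s00 mulr0 in cr.
    by apply: le_trans (sqr_ge0 r); rewrite pmulr_rle0.
  have sp : (0 < s)%R by rewrite lt0r s00.
  have nsr : (nu * s <= r)%R by rewrite -(ler_pM2r sp); lra.
  have := ler_wpM2l (ltW nu0) cr; have := ler_wpM2r r0 nsr; lra.
have := ler_wpM2l (ltW nu0) H.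
by rewrite mulrBr; lra.
Qed.

(** The step decreases the value by at least [(2 L)^-1 |Res x|^2], while the new
    gap is at most a multiple of [|Res x|^2]: eliminate the residual. *)
Lemma value_contraction : (nu < 2 * L)%R -> phi x < +oo ->
  (F (T x) - F p <= (1 - nu / (2 * L)) * (F x - F p))%R.
Proof.
move=> nuL px; have L20 : (0 < 2 * L)%R by rewrite mulr_gt0.
have k1 : (0 <= 1 - nu / (2 * L))%R.
  by rewrite subr_ge0 ler_pdivrMr // mul1r ltW.
have r2 : (enorm (Res x) ^+ 2 <= 2 * L * (F x - F (T x)))%R.
  by have := residual_sqr_le_decrease px; rewrite mulrC ler_pdivrMr // mulrC.
have := le_trans gap_le_residual_sqr (ler_wpM2l k1 r2).
have {1}-> : (nu = 2 * L * (nu / (2 * L)))%R by field; rewrite gt_eqF.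
by rewrite -mulrA (mulrCA _ (2 * L)%R) ler_pM2l //; lra.
Qed.

(** Expanding the square,
    [|T x - p|^2 = |x - p|^2 - 2/L <Res x, x - p> + L^-2 |Res x|^2], and
    averagedness bounds the last term by [4/(3 L) <Res x, x - p>], which leaves
    [- 2/(3 L) <Res x, x - p> <= - 2 nu/(3 L) |x - p|^2]. *)
Lemma distance_contraction :
  (enorm (T x - p) ^+ 2 <= (1 - nu / (2 * L)) * enorm (x - p) ^+ 2)%R.
Proof.
have := residual_dotv_ge x pmin; move: EB.
have -> : (T x - p = (x - p) - L^-1 *: Res x)%R by rewrite fb_step_residualE addrAC.
rewrite !enorm_sqr; move: (x - p)%R (Res x) => a b; rewrite !dotvE (dotvC a b).
have := dotvv_ge0 a.
have Lv0 : (0 < L^-1)%R by rewrite invr_gt0.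
rewrite (_ : 3 / (4 * L) = 3 / 4 * L^-1)%R; last by field; rewrite gt_eqF.
rewrite invfM => a0 /(ler_wpM2l (ltW Lv0)) h1 /(ler_wpM2l (ltW Lv0)) h2.
have : (0 <= L^-1 * nu * dotv a a)%R by rewrite !mulr_ge0 // ltW.
by move: h1 h2; nra.
Qed.

End error_bound_step.

(** The squared residuals are dominated by the decreases of [phi], which
    telescope. *)
Lemma residual_series_le {z : nat -> 'rV[R]_n} {p} : Argmin phi p ->
  phi (z 0%N) < +oo -> (forall i, z i.+1 = T (z i)) ->
  \sum_(0 <= i <oo) (enorm (Res (z i)) ^+ 2)%:E
    <= (2 * L * (F (z 0%N) - F p))%:E.
Proof.
move=> pmin z0 zS; have L20 : (0 < 2 * L)%R by rewrite mulr_gt0.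
have zfin i : phi (z i) < +oo by case: i => // i; rewrite zS; exact: phi_T_fin.
apply: nneseries_EFin_le => [i|N]; first exact: sqr_ge0.
apply: (@le_trans _ _ (2 * L * (F (z 0%N) - F (z N)))%R).
  elim: N => [|N IH]; first by rewrite big_geq // subrr mulr0.
  rewrite big_nat_recr //=; have := residual_sqr_le_decrease (zfin N).
  by rewrite mulrC ler_pdivrMr // -zS; lra.
rewrite ler_pM2l // lerD2l lerN2.
by have := pmin (z N); rewrite (phi_real (zfin N)) (phi_real (Argmin_real pmin)).
Qed.

Lemma cor_EB_nearest {nu : R} {Omega : set 'rV[R]_n} {x p} :
  cor_EB phi Res nu Omega -> Omega x -> phi x < +oo -> proj_crit phi x p ->
  (nu * enorm (x - p) ^+ 2 <= dotv (Res x) (x - p))%R.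
Proof.
move=> [_ /(_ x) EB] Ox px pp; have := EB (conj Ox px).
rewrite (crit_Argmin dom_phi) (dist_Argmin pp) -EFin_expe -EFinM => H.
rewrite -lee_fin; apply: le_trans H _.
by apply: ereal_inf_lbound; exists p.
Qed.

End forward_backward.

(** * Linear convergence and the error bound *)

Lemma res_tailS {R : realType} {n : nat} (Res : 'rV[R]_n -> 'rV[R]_n) x k :
  res_tail Res x k = (enorm (Res (x k)) ^+ 2)%:E + res_tail Res x k.+1.
Proof.
have a0 i : 0 <= (enorm (Res (x (k + i)%N)) ^+ 2)%:E by rewrite lee_fin sqr_ge0.
rewrite /res_tail nneseries_recl // addn0; congr (_ + _).
rewrite -(nneseries_addn 1) //; apply: eq_eseriesr => i _.
by rewrite addn1 addSnnS.
Qed.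

Theorem corollary7 (R : realType) (n : nat) (L eps : R)
    (f : 'rV[R]_n -> R) (g : 'rV[R]_n -> \bar R)
    (phi := fun x => (f x)%:E + g x)
    (Omega := sublevel phi eps) (Res := residual L f g)
    (hL : (0 < L)%R) (heps : (0 < eps)%R)
    (hf : smooth_convex L f) (hg : Gamma0 g)
    (hmin : Argmin phi !=set0) :
  (forall nu : R, cor_EB phi Res nu Omega -> (nu < 2 * L)%R ->
   forall x0, Omega x0 ->
   let x := fbs L f g x0 in let S := res_tail Res x in
   forall k : nat,
   [/\ phi (x k.+1) - minval phi
         <= (1 - nu / (2 * L))%:E * (phi (x k) - minval phi),
       dist (x k.+1) (Argmin phi) ^+ 2
         <= (1 - nu / (2 * L))%:E * dist (x k) (Argmin phi) ^+ 2,
       S k < +oo &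
       S k.+1 <= (1 - nu / (2 * L))%:E * S k])
  /\
  (forall tau : R, (0 < tau < 1)%R ->
   (forall x0, Omega x0 ->
    let x := fbs L f g x0 in
    forall k : nat,
      dist (x k.+1) (Argmin phi) ^+ 2 <= tau%:E * dist (x k) (Argmin phi) ^+ 2) ->
   cor_EB phi Res (L / 2 * (1 - Num.sqrt tau) ^+ 2) Omega).
Proof.
have [q qmin] := hmin.
have qfin : phi q < +oo := Argmin_real hg qmin.
have phiE y : phi y < +oo -> phi y = (fine (phi y))%:E := phi_real hg.
pose T y := prox L^-1 g (y - L^-1 *: grad f y)%R.
have Tfin y : phi (T y) < +oo := phi_T_fin hL hf hg hmin y.
have OmegaE y : Omega y <-> phi y <= phi q + eps%:E.
  by rewrite /Omega /sublevel /= (minvalE qmin).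
have Omega_fin y : Omega y -> phi y < +oo.
  by move=> /OmegaE /le_lt_trans; apply; rewrite (phiE q qfin) -EFinD ltry.
have nearest_Argmin y p : proj_crit phi y p -> Argmin phi p.
  by case; rewrite (crit_Argmin (dom_phi hg)).
split=> [nu EB nuL x0 Ox0 x S k | tau /andP[tau0 tau1] H].
- have nu0 : (0 < nu)%R by case: EB.
  have Ox i : Omega (x i).
    elim: i => // i Oxi; apply/OmegaE; move/OmegaE: (Oxi); apply: le_trans.
    have xfin := Omega_fin _ Oxi.
    have := residual_sqr_le_decrease hL hf hg hmin xfin.
    rewrite -/phi (phiE _ xfin) (phiE (x i.+1) (Tfin _)) lee_fin -subr_ge0.
    by apply: le_trans; rewrite mulr_ge0 ?sqr_ge0 // invr_ge0 mulr_ge0 // ltW.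
  have xfin i : phi (x i) < +oo := Omega_fin _ (Ox i).
  have [p pp] := proj_crit_exists hf hg hmin (x k).
  have pmin : Argmin phi p := nearest_Argmin _ _ pp.
  have pEB := cor_EB_nearest hg EB (Ox k) (xfin k) pp.
  have SB := residual_series_le hL hf hg (z := fun i => x (k.+1 + i)%N) hmin pmin
    (xfin _) (fun i => congr1 x (addnS k.+1 i)).
  have S_ge0 i : 0 <= S i.
    by apply: nneseries_ge0 => j _ _; rewrite lee_fin sqr_ge0.
  have gap := gap_le_residual_sqr hL hf hg hmin nu0 pmin pEB.
  have Sk := res_tailS Res x k; rewrite -/S in Sk.
  have : S k.+1 <= (2 * L * (fine (phi (x k.+1)) - fine (phi p)))%:E.
    by have := SB; rewrite addn0.
  case SE : (S k.+1) (S_ge0 k.+1) => [s||] // _; rewrite lee_fin => sB.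
  split.
  + have minE : minval phi = (fine (phi p))%:E.
      by rewrite (minvalE pmin); exact: phiE (Argmin_real hg pmin).
    rewrite minE (phiE _ (xfin k.+1)) (phiE _ (xfin k)) -!EFinB -EFinM lee_fin.
    exact: (value_contraction hL hf hg hmin nu0 pmin pEB nuL (xfin k)).
  + have [p' pp'] := proj_crit_exists hf hg hmin (x k.+1).
    rewrite (dist_Argmin hg pp) (dist_Argmin hg pp') -!EFin_expe -EFinM lee_fin.
    apply: le_trans (distance_contraction hL hf hg hmin nu0 pmin pEB).
    rewrite ler_pXn2r ?nnegrE ?enorm_ge0 //; apply: (proj2 pp').
    exact: (proj1 pp).
  + by rewrite Sk SE -EFinD ltry.
  + rewrite Sk SE -EFinD -EFinM lee_fin.
    (* [S k.+1 <= 2 L (gap at x k.+1)] and the bound of that gap by [|Res (x k)|^2]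
       give [nu/(2 L) S k.+1 <= (1 - nu/(2 L)) |Res (x k)|^2]. *)
    have kappa0 : (0 <= nu / (2 * L))%R by rewrite divr_ge0 ?mulr_ge0 ?ltW.
    have := ler_wpM2l kappa0 sB.
    by rewrite mulrA divfK ?mulf_neq0 ?gt_eqF //; lra.
- have st1 : (Num.sqrt tau < 1)%R by rewrite -sqrtr1 ltr_sqrt.
  split; first by rewrite mulr_gt0 ?divr_gt0 // exprn_gt0 // subr_gt0.
  move=> x [Ox xfin]; apply: le_ereal_inf_tmp => _ [p pp <-].
  have pmin := nearest_Argmin _ _ pp.
  rewrite (crit_Argmin (dom_phi hg)) (dist_Argmin hg pp) -EFin_expe -EFinM.
  rewrite lee_fin.
  have [p' pp'] := proj_crit_exists hf hg hmin (T x).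
  have : dist (T x) (Argmin phi) ^+ 2 <= tau%:E * dist x (Argmin phi) ^+ 2.
    exact: H x Ox 0%N.
  rewrite (dist_Argmin hg pp) (dist_Argmin hg pp') -!EFin_expe -EFinM lee_fin.
  move=> contr.
  (* The displacement [L^-1 |Res x|] of a contracting step is at least
     [(1 - sqrt tau) d(x)], so the residual is large; averagedness then bounds
     [<Res x, x - p>] from below by its square. *)
  have step : (enorm (T x - p') <= Num.sqrt tau * enorm (x - p))%R.
    rewrite -(@ler_pXn2r _ 2) ?nnegrE ?mulr_ge0 ?enorm_ge0 ?sqrtr_ge0 //.
    by rewrite exprMn (sqr_sqrtr (ltW tau0)).
  have tri : (enorm (x - p) <= L^-1 * enorm (Res x) + enorm (T x - p'))%R.
    have Lv0 : (0 <= L^-1)%R by rewrite invr_ge0 ltW.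
    apply: le_trans (proj2 pp p' (proj1 pp')) _.
    have -> : (x - p' = L^-1 *: Res x + (T x - p'))%R.
      have TxE : T x = (x - L^-1 *: Res x)%R by exact: fb_step_residualE.
      by rewrite TxE addrA subrKC.
    by apply: le_trans (enormD _ _) _; rewrite (enormZ Lv0).
  have Rlow : (L * (1 - Num.sqrt tau) * enorm (x - p) <= enorm (Res x))%R.
    rewrite -mulrA -ler_pdivlMl //; lra.
  have := residual_dotv_ge hL hf hg hmin x pmin; apply: le_trans.
  have -> : (L / 2 * (1 - Num.sqrt tau) ^+ 2 * enorm (x - p) ^+ 2 =
      (2 * L)^-1 * (L * (1 - Num.sqrt tau) * enorm (x - p)) ^+ 2)%R.
    by field; rewrite gt_eqF.
  have Lv0 : (0 < (2 * L)^-1)%R by rewrite invr_gt0 mulr_gt0.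
  have sqle : ((L * (1 - Num.sqrt tau) * enorm (x - p)) ^+ 2
      <= enorm (Res x) ^+ 2)%R.
    rewrite ler_pXn2r ?nnegrE ?mulr_ge0 ?enorm_ge0 ?subr_ge0 // ltW //.
  apply: le_trans (ler_wpM2l (ltW Lv0) sqle) _.
  rewrite ler_wpM2r ?sqr_ge0 //.
  rewrite (_ : 3 / (4 * L) = 3 / 2 * (2 * L)^-1)%R; first by lra.
  by field; rewrite gt_eqF.
Qed.
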